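(* As $n\to\infty$, $$z_3(n, K(2,2,7)) = n^{11/4-o(1)},$$ that is, $\dfrac{\log z_3(n,K(2,2,7))}{\log n}\to \dfrac{11}{4}$ as $n\to\infty$.
   Context: $K(2,2,7)$ denotes the complete $3$-partite $3$-uniform hypergraph: its vertex set is a disjoint union of sets $S_1,S_2,S_3$ with $|S_1|=|S_2|=2$, $|S_3|=7$, and its edges are all sets $\{x_1,x_2,x_3\}$ with $x_i\in S_i$. The Zarankiewicz number $z_3(n,K(2,2,7))$ is the maximum number of edges in a $3$-partite $3$-uniform hypergraph $H$ with (ordered, disjoint) parts $X_1,X_2,X_3$, each of size $n$ (every edge has exactly one vertex in each part), such that there is no copy of $K(2,2,7)$ in $H$ with $S_i\subset X_i$ for $i=1,2,3$; copies placed with some $S_i\not\subset X_i$ are allowed. *)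

(* Defs.v *)
From mathcomp Require Import all_boot all_order all_algebra.

Set Implicit Arguments.
Unset Strict Implicit.
Unset Printing Implicit Defensive.

Import GRing.Theory.
Local Open Scope ring_scope.

Definition complete3 (T : finType) (S1 S2 S3 : {set T}) : {set {set T}} :=
  [set e : {set T} |
    [exists x1 in S1, exists x2 in S2, exists x3 in S3, e == [set x1; x2; x3]]].

(* Three disjoint copies of an n-element set. *)
Definition vertex (n : nat) : finType := ('I_3 * 'I_n)%type.

Definition part (n : nat) (i : 'I_3) : {set vertex n} := [set v | v.1 == i].

(* As the three parts cover all vertices, every edge then has cardinality 3. *)
Definition tripartite (n : nat) (H : {set {set vertex n}}) : bool :=
  [forall e in H, forall i, #|e :&: part n i| == 1%N].

(* Copies are subhypergraphs, not necessarily induced, and respect the order of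
   the parts: the class of size s1 must lie in part 0, the one of size s2 in
   part 1 and the one of size s3 in part 2. *)
Definition has_ordered_copy (n s1 s2 s3 : nat) (H : {set {set vertex n}}) : bool :=
  [exists S1 : {set vertex n}, exists S2 : {set vertex n},
   exists S3 : {set vertex n},
    [&& S1 \subset part n 0, S2 \subset part n 1, S3 \subset part n 2,
        #|S1| == s1, #|S2| == s2, #|S3| == s3
      & complete3 S1 S2 S3 \subset H]].

Definition z3 (n s1 s2 s3 : nat) : nat :=
  \max_(H : {set {set vertex n}} |
        tripartite H && ~~ has_ordered_copy s1 s2 s3 H) #|H|.

(* Main.v *)
Require Import Defs.
From mathcomp Require Import all_boot all_order all_algebra all_solvable all_field.
From mathcomp Require Import zify ring lra.

Set Implicit Arguments.
Unset Strict Implicit.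
Unset Printing Implicit Defensive.

Import Order.TTheory GRing.Theory Num.Theory.

(** Upper bound: counting the homomorphisms of K(2,2,1) by applying
    Cauchy-Schwarz twice gives |E|^4 <= 8 n^11.

    Lower bound: let A be a bipartite graph without K(4,7), with about n vertices
    on each side and about n^(7/4) edges (a projective norm graph), and let the
    pairs (x, y) of a dense bipartite graph G be coloured by vertices of A so
    that every 4-cycle of G receives four distinct colours. Then the triples
    (x, y, z) with (x, y) in G and z adjacent in A to the colour of (x, y)
    contain no K(2,2,7). As in the constructions of Behrend and of Ruzsa and
    Szemeredi, x and y range over the box [d]^k, G consists of the pairs at a
    fixed distance, and (x, y) has colour 2 y - x, the third term of the
    progression x, y, 2 y - x: a sphere contains no three-term progression. This G
    has at least d^(2k) / (k d^2) edges, so the loss n^(O(1/k)) is arbitrarily small. *)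

(** * Hypergraphs as sets of triples *)

(** Ordered [K(2,2,s)]-freeness. Arbitrary finite types serve as parts, so that the construction
    keeps its natural vertex sets. *)
Definition rectangle_free (X Y Z : finType) (s : nat) (E : {set X * Y * Z}) : Prop :=
  forall x x' y y', x != x' -> y != y' ->
    #|[set z | [&& (x, y, z) \in E, (x, y', z) \in E,
                   (x', y, z) \in E & (x', y', z) \in E]]| < s.

Lemma part_triple_inj n (a b c a' b' c' : vertex n) :
  a \in part n 0%R -> b \in part n 1%R -> c \in part n 2%R ->
  a' \in part n 0%R -> b' \in part n 1%R -> c' \in part n 2%R ->
  [set a; b; c] = [set a'; b'; c'] -> [/\ a = a', b = b' & c = c'].
Proof.
rewrite !inE => /eqP a1 /eqP b1 /eqP c1 /eqP a1' /eqP b1' /eqP c1' /setP eqs.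
have := eqs a; have := eqs b; have := eqs c.
rewrite !inE !eqxx ?orbT.
have neq (u v : vertex n) : u.1 != v.1 -> (u == v) = false.
  by move=> uv; apply: contraNF uv => /eqP->.
rewrite (neq a b') ?(neq a c') ?(neq b a') ?(neq b c') ?(neq c a') ?(neq c b')
  ?a1 ?b1 ?c1 ?a1' ?b1' ?c1' //.
by rewrite !orbF /= => /esym/eqP-> /esym/eqP-> /esym/eqP->.
Qed.

Section Edge.
Variable n : nat.
Implicit Type t : 'I_n * 'I_n * 'I_n.

Definition edge t : {set vertex n} :=
  [set (0%R, t.1.1); (1%R, t.1.2); (2%R, t.2)].

Lemma edge_inj : injective edge.
Proof.
move=> [[x y] z] [[x' y'] z'] /part_triple_inj; rewrite !inE /= => /(_ isT isT isT isT isT isT).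
by case=> [[->] [->] [->]].
Qed.

Lemma card_edgeI_part t i : #|edge t :&: part n i| = 1.
Proof.
pose w : 'I_n := if i == 0%R then t.1.1 else if i == 1%R then t.1.2 else t.2.
suff -> : edge t :&: part n i = [set (i, w)] by rewrite cards1.
apply/setP=> -[j v]; rewrite !inE !xpair_eqE /=.
have [->|ji] := eqVneq j i; rewrite ?andbT ?andbF //.
by rewrite /w; case: i {w} => -[|[|[|//]]] i3 /=; rewrite ?orbF.
Qed.

Lemma edgeP e : (forall i, #|e :&: part n i| = 1) -> exists t, e = edge t.
Proof.
move=> e1.
have get i : exists w : 'I_n, forall v, ((i, v) \in e) = (v == w).
  have /cards1P[[j w] /setP ew] : #|e :&: part n i| == 1 by rewrite e1.
  have /eqP ji : j == i by have := ew (j, w); rewrite !inE eqxx => /andP[].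
  by exists w => v; have := ew (i, v); rewrite !inE ji eqxx andbT xpair_eqE eqxx.
have [[[x ex] [y ey]] [z ez]] := (get 0%R, get 1%R, get 2%R).
exists (x, y, z); apply/setP=> -[i v]; rewrite !inE !xpair_eqE /=.
have [->|i0] := eqVneq i 0%R; first by rewrite ex /= !orbF.
have [->|i1] := eqVneq i 1%R; first by rewrite ey /= !orbF.
have -> : i = 2%R by apply/val_inj; case: i i0 i1 => -[|[|[|]]].
by rewrite ez.
Qed.

Lemma z3_leq s m :
  (forall E : {set 'I_n * 'I_n * 'I_n}, rectangle_free s E -> #|E| <= m) ->
  z3 n 2 2 s <= m.
Proof.
move=> Em; apply/bigmax_leqP=> H /andP[/forall_inP triH noH].
have subH : H \subset edge @: [set t | edge t \in H].
  apply/subsetP=> e eH; have [t et] : exists t, e = edge t.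
    by apply: edgeP => i; apply/eqP/(forallP (triH e eH)).
  by apply/imsetP; exists t; rewrite ?inE -?et.
apply: leq_trans (subset_leq_card subH) _.
rewrite card_imset; last exact: edge_inj.
apply: Em => x x' y y' xx yy; rewrite ltnNge; apply: contra noH => /card_geqP[zs [uzs szs zsC]].
apply/existsP; exists [set (0%R, x); (0%R, x')]; apply/existsP; exists [set (1%R, y); (1%R, y')].
apply/existsP; exists [set (2%R, z) | z in zs]; apply/and5P; split.
- by apply/subsetP=> v; rewrite !inE => /orP[]/eqP->.
- by apply/subsetP=> v; rewrite !inE => /orP[]/eqP->.
- by apply/subsetP=> v /imsetP[z _ ->]; rewrite inE.
- by rewrite cards2 xpair_eqE eqxx xx.
apply/and3P; split; first by rewrite cards2 xpair_eqE eqxx yy.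
  by rewrite card_imset ?(card_uniqP uzs) ?szs // => z z' [].
apply/subsetP=> e; rewrite inE.
case/exists_inP=> v1 vS1 /exists_inP[v2 vS2 /exists_inP[v3 vS3 /eqP->]].
case/imsetP: vS3 => z /zsC; rewrite !inE => /and4P[h1 h2 h3 h4] ->.
by move: vS1 vS2; rewrite !inE => /orP[]/eqP-> /orP[]/eqP->.
Qed.

(** Injections into ['I_n] transport [E] to a hypergraph; an ordered copy there pulls back to two
    [x], two [y] and [s] common [z]. *)
Lemma z3_geq (X Y Z : finType) s (E : {set X * Y * Z}) :
  0 < s -> #|X| <= n -> #|Y| <= n -> #|Z| <= n -> rectangle_free s E ->
  #|E| <= z3 n 2 2 s.
Proof.
move=> s0 Xn Yn Zn freeE.
have emb (T : finType) (Tn : #|T| <= n) : exists f : T -> 'I_n, injective f.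
  exists (fun x => widen_ord Tn (enum_rank x)) => x y /(congr1 val)/= /val_inj.
  exact: enum_rank_inj.
have [[[f f_inj] [g g_inj]] [h h_inj]] := (emb _ Xn, emb _ Yn, emb _ Zn).
pose tr (t : X * Y * Z) := (f t.1.1, g t.1.2, h t.2).
have tr_inj : injective tr by move=> [[x y] z] [[x' y'] z'] [/f_inj-> /g_inj-> /h_inj->].
rewrite -(card_imset _ (inj_comp edge_inj tr_inj)) /z3.
apply: leq_bigmax_cond; apply/andP; split.
  apply/forall_inP=> _ /imsetP[t _ ->]; apply/forallP=> i.
  by rewrite card_edgeI_part.
apply/negP=> /existsP[S1 /existsP[S2 /existsP[S3]]].
move=> /and5P[/subsetP S1p /subsetP S2p /subsetP S3p cS1 /and3P[cS2 /eqP cS3 /subsetP sub]].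
have /cards2P[a [a' [aa S1E]]] := cS1; have /cards2P[b [b' [bb S2E]]] := cS2.
have hit u v w : u \in S1 -> v \in S2 -> w \in S3 -> exists t : X * Y * Z,
    [/\ t \in E, u = (0%R, f t.1.1), v = (1%R, g t.1.2) & w = (2%R, h t.2)].
  move=> uS vS wS; have /imsetP[t tE] : [set u; v; w] \in (edge \o tr) @: E.
    apply: sub; rewrite inE; apply/exists_inP; exists u => //.
    by apply/exists_inP; exists v => //; apply/exists_inP; exists w.
  move=> /part_triple_inj; rewrite S1p // S2p // S3p // !inE => /(_ isT isT isT isT isT isT).
  by case=> eu ev ew; exists t.
(* Preimages of [a], [a'], [b], [b'] are read off from edges, which takes a vertex of [S3]; [0 < s]
   provides one. *)
have [c cS] : exists c, c \in S3 by apply/set0Pn; rewrite -card_gt0 cS3.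
have [aS aS'] : a \in S1 /\ a' \in S1 by rewrite S1E !inE !eqxx orbT.
have [bS bS'] : b \in S2 /\ b' \in S2 by rewrite S2E !inE !eqxx orbT.
have [[[x y] z] [_ /= ax b_y _]] := hit a b c aS bS cS.
have [[[x' y'] z'] [_ /= ax' by' _]] := hit a' b' c aS' bS' cS.
have xx : x != x' by apply: contra_neq aa => xx; rewrite ax ax' xx.
have yy : y != y' by apply: contra_neq bb => yy; rewrite b_y by' yy.
have := freeE x x' y y' xx yy; rewrite ltnNge -cS3 => /negP; apply.
set C := [set _ | _]; rewrite -(card_imset C h_inj).
rewrite -(@card_imset _ _ (fun v => (2%R : 'I_3, v)) (h @: C)); last by move=> ? ? [].
apply/subset_leq_card/subsetP=> w wS.
have [[[x1 y1] z1] [t1 /= e1 e1' wz]] := hit a b w aS bS wS.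
apply/imsetP; exists (h z1) => //; apply/imsetP; exists z1 => //; rewrite inE.
have inE u v : u \in S1 -> v \in S2 ->
    forall x y, u = (0%R, f x) -> v = (1%R, g y) -> (x, y, z1) \in E.
  move=> uS vS x0 y0 ux vy; have [[[x2 y2] z2] /= [t2 e2 e2' wz2]] := hit u v w uS vS wS.
  move: ux vy wz2; rewrite e2 e2' wz => -[/f_inj <-] [/g_inj <-] [/h_inj ->] //.
by apply/and4P; split; [apply: (inE a b)|apply: (inE a b')|apply: (inE a' b)|apply: (inE a' b')].
Qed.
End Edge.

(** * The upper bound *)

(** Cauchy-Schwarz, from [2 f i f j <= f i ^ 2 + f j ^ 2] summed over all pairs. *)
Lemma sum_sqr_leq (I : finType) (f : I -> nat) :
  (\sum_i f i) ^ 2 <= #|I| * \sum_i f i ^ 2.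
Proof.
rewrite -mulnn big_distrlr /= -(leq_pmul2l (ltn0Sn 1)) big_distrr /=.
have -> : 2 * (#|I| * \sum_i f i ^ 2) = \sum_i \sum_j (f i ^ 2 + f j ^ 2).
  under [RHS]eq_bigr do rewrite big_split /= sum_nat_const.
  rewrite big_split /= sum_nat_const -big_distrr /=.
  by rewrite mul2n -addnn.
by apply: leq_sum => i _; rewrite big_distrr; apply: leq_sum => j _; apply: nat_Cauchy.
Qed.

Lemma rectangle_free_card n s (E : {set 'I_n * 'I_n * 'I_n}) :
  rectangle_free s.+1 E -> #|E| ^ 4 <= s.+2 * n ^ 11.
Proof.
move=> freeE; pose e x y z : nat := (x, y, z) \in E.
(* [codeg (z, (x, x'))] counts the [y] forming an edge with [z] and each of [x], [x']; the sum of
   its squares counts the homomorphisms of K(2,2,1). *)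
pose codeg (p : 'I_n * ('I_n * 'I_n)) := \sum_y e p.2.1 y p.1 * e p.2.2 y p.1.
have cE : #|E| = \sum_(p : 'I_n * 'I_n) \sum_x e x p.2 p.1.
  rewrite -sum1_card big_mkcond /= [RHS](eq_bigr (fun p => \sum_x e x p.2 p.1)) //.
  rewrite pair_bigA /=.
  rewrite (reindex (fun q : ('I_n * 'I_n) * 'I_n => (q.2, q.1.2, q.1.1))) /=; last first.
    by exists (fun t => (t.2, t.1.2, t.1.1)) => -[[]].
  by apply: eq_bigr => q _; rewrite /e; case: (_ \in _).
have step1 : #|E| ^ 2 <= n ^ 2 * \sum_p codeg p.
  rewrite cE; apply: leq_trans (sum_sqr_leq _) _.
  rewrite card_prod card_ord mulnn leq_mul2l; apply/orP; right.
  rewrite /codeg -(pair_bigA _ (fun z q => \sum_y e q.1 y z * e q.2 y z)) /=.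
  rewrite -(pair_bigA _ (fun z y => (\sum_x e x y z) ^ 2)) /=; apply: leq_sum => z _.
  rewrite exchange_big /=; apply: leq_sum => y _.
  by rewrite -mulnn big_distrlr pair_bigA.
have step2 : (\sum_p codeg p) ^ 2 <= n ^ 3 * \sum_p codeg p ^ 2.
  apply: leq_trans (sum_sqr_leq _) _.
  by rewrite !card_prod card_ord -[n * (n * n)]/(n ^ 3).
have step3 : \sum_p codeg p ^ 2 <= s.+2 * n ^ 4.
  have -> : \sum_p codeg p ^ 2 = \sum_x \sum_x' \sum_y \sum_y'
      #|[set z | [&& (x, y, z) \in E, (x, y', z) \in E, (x', y, z) \in E & (x', y', z) \in E]]|.
    rewrite -(pair_bigA _ (fun z q => (\sum_y e q.1 y z * e q.2 y z) ^ 2)) /= exchange_big /=.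
    rewrite -(pair_bigA _ (fun x x' => \sum_z (\sum_y e x y z * e x' y z) ^ 2)) /=.
    apply: eq_bigr => x _; apply: eq_bigr => x' _.
    under eq_bigr do rewrite -mulnn big_distrlr /=.
    rewrite exchange_big; apply: eq_bigr => y _; rewrite exchange_big; apply: eq_bigr => y' _ /=.
    rewrite -sum1_card [RHS]big_mkcond /=; apply: eq_bigr => z _; rewrite inE /e.
    by do 4 case: (_ \in E).
  (* The degenerate cases [x = x'] and [y = y'] have only the trivial bound [n]; each contributes
     [n ^ 4] in total, whence [s.+2]. *)
  have bound x x' y y' :
      #|[set z | [&& (x, y, z) \in E, (x, y', z) \in E, (x', y, z) \in E & (x', y', z) \in E]]|
      <= s + (x == x') * n + (y == y') * n.
    have Cn (C : {set 'I_n}) : #|C| <= n by rewrite -[leqRHS]card_ord max_card.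
    have := freeE x x' y y'; case: eqVneq => [_ _|_ /(_ isT)].
      by rewrite mul1n; apply: leq_trans (Cn _) _; lia.
    case: eqVneq => [_ _|_ /(_ isT)]; last by rewrite ltnS !mul0n !addn0.
    by rewrite mul1n; apply: leq_trans (Cn _) _; lia.
  have delta (a : 'I_n) c : \sum_b (a == b) * c = c.
    rewrite -big_distrl /= (bigD1 a) //= eqxx big1 ?addn0 ?mul1n // => b.
    by rewrite eq_sym => /negPf->.
  apply: leq_trans (_ : \sum_(x < n) \sum_(x' < n) \sum_(y < n) \sum_(y' < n)
      (s + (x == x') * n + (y == y') * n) <= _).
    by do 4! [apply: leq_sum => ? _].
  have sum_y' x x' y : \sum_(y' < n) (s + (x == x') * n + (y == y') * n) =
      n * (s + 1) + (x == x') * (n * n).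
    by rewrite big_split /= delta sum_nat_const card_ord; lia.
  have sum_y x x' : \sum_(y < n) \sum_(y' < n) (s + (x == x') * n + (y == y') * n) =
      n * (n * (s + 1)) + (x == x') * (n * (n * n)).
    by under eq_bigr do rewrite sum_y'; rewrite sum_nat_const card_ord; lia.
  have sum_x' x : \sum_(x' < n) \sum_(y < n) \sum_(y' < n) (s + (x == x') * n + (y == y') * n) =
      s.+2 * n ^ 3.
    under eq_bigr do rewrite sum_y; rewrite big_split /= delta sum_nat_const card_ord.
    by rewrite !expnS; lia.
  by under eq_bigr do rewrite sum_x'; rewrite sum_nat_const card_ord [n ^ 4]expnS; lia.
have -> : #|E| ^ 4 = (#|E| ^ 2) ^ 2 by rewrite -expnM.
have -> : s.+2 * n ^ 11 = (n ^ 2) ^ 2 * (n ^ 3 * (s.+2 * n ^ 4)).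
  by rewrite -expnM !(mulnCA _ s.+2) -!expnD.
apply: leq_trans (_ : (n ^ 2 * \sum_p codeg p) ^ 2 <= _); first by rewrite leq_exp2r.
rewrite expnMn leq_mul2l; apply/orP; right; apply: leq_trans step2 _.
by rewrite leq_mul2l step3 orbT.
Qed.

(** * Coloured rectangles *)

Lemma rectangle_free_comp (X Y C Z : finType) s (G : X -> Y -> bool) (col : X -> Y -> C)
    (A : C -> Z -> bool) :
  (forall c1 c2 c3 c4, uniq [:: c1; c2; c3; c4] ->
     #|[set z | [&& A c1 z, A c2 z, A c3 z & A c4 z]]| <= s) ->
  (forall x x' y y', x != x' -> y != y' -> G x y -> G x y' -> G x' y -> G x' y' ->
     uniq [:: col x y; col x y'; col x' y; col x' y']) ->
  rectangle_free s.+1 [set t : X * Y * Z | G t.1.1 t.1.2 && A (col t.1.1 t.1.2) t.2].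
Proof.
move=> Afree rainbow x x' y y' xx yy; rewrite ltnS; set K := [set _ | _].
(* A member of [K] certifies that the four pairs lie in [G], as the rainbow hypothesis demands. *)
have [->|/set0Pn[z]] := eqVneq K set0; first by rewrite cards0.
rewrite !inE /= => /and4P[/andP[g1 _] /andP[g2 _] /andP[g3 _] /andP[g4 _]].
apply: leq_trans (Afree _ _ _ _ (rainbow x x' y y' xx yy g1 g2 g3 g4)).
by apply/subset_leq_card/subsetP=> w; rewrite !inE /= g1 g2 g3 g4.
Qed.

Lemma card_comp_geq (X Y C Z : finType) m (G : X -> Y -> bool) (col : X -> Y -> C)
    (A : C -> Z -> bool) :
  (forall c, m <= #|[set z | A c z]|) ->
  #|[set p : X * Y | G p.1 p.2]| * m <=
  #|[set t : X * Y * Z | G t.1.1 t.1.2 && A (col t.1.1 t.1.2) t.2]|.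
Proof.
move=> degA; set E := [set t : X * Y * Z | _].
have -> : #|E| = \sum_p \sum_z ((p, z) \in E).
  rewrite pair_bigA -sum1_card big_mkcond; apply: eq_bigr => -[p z] _ /=.
  by case: (_ \in E).
have -> : #|[set p : X * Y | G p.1 p.2]| * m = \sum_p G p.1 p.2 * m.
  rewrite -big_distrl -sum1_card big_mkcond; congr (_ * _); apply: eq_bigr => p _.
  by rewrite inE; case: (G _ _).
apply: leq_sum => p _; have [Gp|//] := boolP (G p.1 p.2).
rewrite mul1n; apply: leq_trans (degA (col p.1 p.2)) _.
rewrite -sum1_card big_mkcond; apply: leq_sum => z _.
by rewrite !inE /= Gp; case: (A _ z).
Qed.

Lemma pigeonhole (T : finType) (f : T -> nat) m :
  (forall p, f p < m) -> exists r, #|T| <= m * #|[set p | f p == r]|.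
Proof.
move=> fm; have [T0|[p0 _]] : #|T| = 0 \/ exists p : T, true.
  by have [/eqP|/card_gt0P[p _]] := posnP #|T|; [move/eqP; left|right; exists p].
  by exists 0; rewrite T0.
have m0 : 0 < m by apply: leq_ltn_trans (fm p0).
pose N (r : nat) := #|[set p | f p == r]|.
have -> : #|T| = \sum_(r < m) N r.
  rewrite -sum1_card (partition_big (fun p => Ordinal (fm p)) xpredT) //=.
  by apply: eq_bigr => r _; rewrite /N -sum1_card; apply: eq_bigl => p; rewrite inE.
pose i : 'I_m := [arg max_(i > Ordinal m0) N i]; exists (val i); rewrite -[#|_|]/(N i).
rewrite -[X in X * _]card_ord -sum_nat_const; apply: leq_sum => j _.
by rewrite /i; case: arg_maxnP => // k _; apply.
Qed.

(** * Pairs at a fixed distance in a box *)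

Section Behrend.
Variables k d : nat.
Implicit Types x y : {ffun 'I_k -> 'I_d}.

Definition sqdist x y : nat := \sum_i absz ((x i : int) - (y i : int))%R ^ 2.

Lemma sqdistE x y : (sqdist x y : int) = (\sum_i ((y i : int) - (x i : int)) ^+ 2)%R.
Proof.
rewrite /sqdist -natz natr_sum; apply: eq_bigr => i _.
by rewrite natz; lia.
Qed.

Lemma sqdist_lt x y : 0 < k -> 0 < d -> sqdist x y < k * d ^ 2.
Proof.
move=> k0 d0; apply: (@leq_ltn_trans (k * d.-1 ^ 2)); last first.
  by rewrite ltn_pmul2l // ltn_exp2r //; lia.
rewrite -[k in leqRHS]card_ord -sum_nat_const; apply: leq_sum => i _.
by rewrite leq_exp2r //; move: (ltn_ord (x i)) (ltn_ord (y i)); lia.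
Qed.

Lemma third_term_subproof (a b : 'I_d) : 2 * b + (d - a) < 3 * d.
Proof. by move: (ltn_ord a) (ltn_ord b); lia. Qed.

(** The point [2 y - x], with each coordinate shifted by [d] to be a natural number. *)
Definition third_term x y : {ffun 'I_k -> 'I_(3 * d)} :=
  [ffun i => Ordinal (third_term_subproof (x i) (y i))].

Lemma third_termP x y x' y' i : third_term x y = third_term x' y' ->
  2 * y i + x' i = 2 * y' i + x i.
Proof.
move=> /ffunP/(_ i); rewrite !ffunE => -[].
by move: (ltn_ord (x i)) (ltn_ord (x' i)); lia.
Qed.

(* With a = y - x and b = y' - x', the colour condition gives y' - x = 2 a - b, and
   |2 a - b|^2 + |b|^2 - 2 |a|^2 = 2 |a - b|^2. *)
Lemma third_term_diag x x' y y' :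
  sqdist x y = sqdist x' y' -> sqdist x y' = sqdist x' y' ->
  third_term x y = third_term x' y' -> x = x'.
Proof.
move=> e1 e2 /third_termP e3.
have : (\sum_i (2 * (((y i : int) - (x i : int)) - ((y' i : int) - (x' i : int))) ^+ 2) = 0)%R.
  transitivity ((sqdist x y' : int) + sqdist x' y' - 2 * (sqdist x y : int))%R; last first.
    by rewrite e1 e2; ring.
  rewrite !sqdistE mulr_sumr -big_split -sumrB /=; apply: eq_bigr => i _.
  have -> : (x' i : int) = (2 * (y' i : int) - 2 * (y i : int) + (x i : int))%R.
    by have := e3 i; lia.
  ring.
move/eqP; rewrite psumr_eq0; last by move=> i _; rewrite mulr_ge0 ?sqr_ge0.
move=> /allP all0; apply/ffunP=> i; apply/val_inj => /=.
(* In coordinate [i], [y - x = y' - x'], while equal colours give [2 (y - y') = x - x']; so both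
   differences vanish. *)
have := all0 i (mem_index_enum i); rewrite mulf_eq0 sqrf_eq0 /=.
by have := e3 i; lia.
Qed.

(** Pairs sharing an endpoint differ in colour because [2 y - x] is injective in each argument;
    [third_term_diag] handles the two diagonals. *)
Lemma third_term_rainbow r x x' y y' : x != x' -> y != y' ->
  sqdist x y == r -> sqdist x y' == r -> sqdist x' y == r -> sqdist x' y' == r ->
  uniq [:: third_term x y; third_term x y'; third_term x' y; third_term x' y'].
Proof.
move=> xx yy /eqP r1 /eqP r2 /eqP r3 /eqP r4.
have same_x u v v' : v != v' -> third_term u v != third_term u v'.
  apply: contra_neq => /third_termP e; apply/ffunP=> i; apply/val_inj => /=.
  by have := e i; lia.
have same_y u u' v : u != u' -> third_term u v != third_term u' v.
  apply: contra_neq => /third_termP e; apply/ffunP=> i; apply/val_inj => /=.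
  by have := e i; lia.
rewrite /= !inE !negb_or !same_x // !same_y //= !andbT; apply/andP; split.
  by apply: contra_neq xx => /third_term_diag; apply; congruence.
by apply: contra_neq xx => /third_term_diag; apply; congruence.
Qed.
End Behrend.

(** * The projective norm graph *)

Section ProjectiveNormGraph.
Local Open Scope ring_scope.

(* For a fixed x the system is linear in the products and values f x * g x, f x, g x:
   by Cramer's rule, D times these equal W, S and T divided by U, so that
   D W U - S T vanishes at every solution. At - a1 this polynomial is nonzero,
   whether or not D is. *)
Lemma norm_system_bound (F : fieldType) (a1 a2 a3 b1 b2 b3 c1 c2 c3 k1 k2 k3 : F)
    (f g : F -> F) (rs : seq F) :
  a1 != a2 -> a1 != a3 -> b2 != b3 -> c2 != c3 -> k1 != 0 -> uniq rs ->
  {in rs, forall x, [/\ (x + a1) * (f x + b1) * (g x + c1) = k1,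
                        (x + a2) * (f x + b2) * (g x + c2) = k2
                      & (x + a3) * (f x + b3) * (g x + c3) = k3]} ->
  (size rs <= 6)%N.
Proof.
move=> a12 a13 b23 c23 k10 urs sol.
pose u a : {poly F} := 'X + a%:P.
pose U := u a1 * u a2 * u a3.
(* Expanding equation i gives [f g + c_i f + b_i g = r_i / U]; [D] is the determinant, and [W], [S],
   [T] are the Cramer numerators of [f g], [f], [g]. *)
pose r1 := k1%:P * (u a2 * u a3) - (b1 * c1)%:P * U.
pose r2 := k2%:P * (u a1 * u a3) - (b2 * c2)%:P * U.
pose r3 := k3%:P * (u a1 * u a2) - (b3 * c3)%:P * U.
pose D := (c2 - c1) * (b3 - b1) - (c3 - c1) * (b2 - b1).
pose S := (b2 - b3)%:P * r1 + (b3 - b1)%:P * r2 + (b1 - b2)%:P * r3.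
pose T := (c3 - c2)%:P * r1 + (c1 - c3)%:P * r2 + (c2 - c1)%:P * r3.
pose W := (c2 * b3 - c3 * b2)%:P * r1 + (c3 * b1 - c1 * b3)%:P * r2
          + (c1 * b2 - c2 * b1)%:P * r3.
pose P := D%:P * W * U - S * T.
have szM (p q : {poly F}) m n : (size p <= m.+1)%N -> (size q <= n.+1)%N ->
    (size (p * q)%R <= (m + n).+1)%N.
  by move=> pm qn; apply: leq_trans (size_polyMleq _ _) _; lia.
have szD (p q : {poly F}) n : (size p <= n)%N -> (size q <= n)%N -> (size (p + q)%R <= n)%N.
  by move=> pn qn; apply: leq_trans (size_polyD _ _) _; rewrite geq_max pn.
have szC a (p : {poly F}) n : (size p <= n.+1)%N -> (size (a%:P * p)%R <= n.+1)%N.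
  by move=> pn; apply: (szM _ _ 0%N n) => //; apply: leq_trans (size_polyC_leq1 a) _.
have szu a : (size (u a) <= 2)%N by rewrite /u size_XaddC.
have szU : (size U <= 4)%N by apply: (szM _ _ 2%N 1%N) => //; apply: (szM _ _ 1%N 1%N).
have szr k m v w : (size (k%:P * (u v * u w) - m%:P * U)%R <= 4)%N.
  apply: szD; first by apply: leq_trans (szC _ _ 2%N (szM _ _ 1%N 1%N _ _)) _.
  by rewrite size_polyN szC.
have szL k1' k2' k3' : (size (k1'%:P * r1 + k2'%:P * r2 + k3'%:P * r3)%R <= 4)%N.
  by apply: (szD); [apply: (szD)|]; apply/szC/szr.
have szP : (size P <= 7)%N.
  apply: (szD); last rewrite size_polyN.
    by apply: (szM _ _ 3%N 3%N) => //; apply/szC/szL.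
  by apply: (szM _ _ 3%N 3%N); apply: szL.
have P0 : P != 0.
  suff : P.[- a1] != 0 by apply: contraNneq => ->; rewrite horner0.
  (* At [- a1] the polynomials [U], [r2] and [r3] vanish, so only the [r1] terms of [S * T]
     survive. *)
  have -> : P.[- a1] = - (b2 - b3) * (c3 - c2) * (k1 * (a2 - a1) * (a3 - a1)) ^+ 2.
    rewrite /P /W /S /T /r1 /r2 /r3 /U /u !(hornerD, hornerN, hornerM, hornerC, hornerX); ring.
  rewrite expr2 !(mulf_eq0, oppr_eq0, subr_eq0)
    (eq_sym c3) (eq_sym a2) (eq_sym a3).
  by rewrite !negb_or b23 c23 k10 a12 a13.
have {}P0 := max_poly_roots P0 _ urs.
rewrite -ltnS; apply: leq_trans (P0 _) szP; apply/allP=> x /sol[e1 e2 e3].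
rewrite rootE /P /W /S /T /r1 /r2 /r3 /U /u /D.
(* Replacing each [k_i] by its left side makes [r_i] equal to [U (f g + c_i f + b_i g)], and the
   vanishing becomes a polynomial identity. *)
rewrite !(hornerD, hornerN, hornerM, hornerC, hornerX) -e1 -e2 -e3.
by apply/eqP; ring.
Qed.

(* Adjacency in the projective norm graph, for L of order q^3 and h of order q - 1:
   the exponent q^2 + q + 1 is the norm to the subfield of order q, and i in 'I_q.-1
   encodes the element h^i of that subfield. *)
Definition norm_adj (L : finFieldType) (q : nat) (h : L) (u v : L * 'I_q.-1) : bool :=
  (u.1 + v.1) ^+ (q ^ 2 + q + 1) == h ^+ (u.2 + v.2).

Section NormGraph.
Variables (L : finFieldType) (q : nat) (h : L).
Hypotheses (q_char : [pchar L].-nat q) (cardL : #|L| = (q ^ 3)%N).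
Hypothesis (h_prim : q.-1.-primitive_root h).
Implicit Types (u v : L * 'I_q.-1) (x y : L).

Let h_neq0 n : h ^+ n != 0.
Proof. by rewrite expf_neq0 // (prim_root_eq0 h_prim) -lt0n (prim_order_gt0 h_prim). Qed.

Let frob3 x : x ^+ (q ^ 3) = x.
Proof. by rewrite -cardL expf_card. Qed.

Lemma frobenius_inj : injective (fun x : L => x ^+ q).
Proof. by move=> x y /= exy; rewrite -(frob3 x) -(frob3 y) expnS !exprM exy. Qed.

Lemma frobenius2_inj : injective (fun x : L => x ^+ (q ^ 2)).
Proof. by move=> x y /= exy; rewrite -(frob3 x) -(frob3 y) expnSr (exprM x) (exprM y) exy. Qed.

(** The norm is the product of the three conjugates, and the Frobenius powers are additive. This is
    the shape required by [norm_system_bound]. *)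
Lemma norm_polyE x y :
  (x + y) ^+ (q ^ 2 + q + 1) = (x + y) * (x ^+ q + y ^+ q) * (x ^+ (q ^ 2) + y ^+ (q ^ 2)).
Proof.
rewrite -exprDn_pchar // -exprDn_pchar; last by rewrite pnatX q_char.
by rewrite !exprD expr1; ring.
Qed.

Lemma norm_adj_injr u v v' : norm_adj h u v -> norm_adj h u v' -> v.1 = v'.1 -> v = v'.
Proof.
case: u v v' => [a i] [b j] [b' j'] /= /eqP /= e1 /eqP /= e2 ebb.
move: e1; rewrite /= ebb e2 => /eqP; rewrite (eq_prim_root_expr h_prim) eqn_modDl !modn_small //.
by move=> /eqP/val_inj->.
Qed.

Lemma norm_adjC u v : norm_adj h u v = norm_adj h v u.
Proof. by rewrite /norm_adj (addrC u.1) (addnC u.2). Qed.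

(* Inverting B + A4 turns the four equations N(A_i + B) = a_i b into three
   equations N(1/(B + A4) + 1/(A_i - A4)) = k_i. *)
Lemma norm_adj_free u1 u2 u3 u4 : uniq [:: u1; u2; u3; u4] ->
  (#|[set v | [&& norm_adj h u1 v, norm_adj h u2 v, norm_adj h u3 v & norm_adj h u4 v]]| <= 6)%N.
Proof.
set C := [set _ | _] => uu.
have [->|/set0Pn[w]] := eqVneq C set0; first by rewrite cards0.
rewrite inE => /and4P[w1 w2 w3 w4].
(* Through the common neighbour [w], distinct [u_i] have distinct first coordinates, so the inverses
   [a u] below are distinct and nonzero. *)
have neqA u u' : norm_adj h u w -> norm_adj h u' w -> u != u' -> u.1 - u4.1 != u'.1 - u4.1.
  move=> uw uw'; apply: contra_neq => /addIr; apply: (@norm_adj_injr w); by rewrite norm_adjC.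
have inv0 u : norm_adj h u w -> u != u4 -> u.1 - u4.1 != 0.
  by move=> uw /(neqA _ _ uw w4); rewrite subrr.
move: uu; rewrite /= !inE !negb_or => /and4P[/and3P[n12 n13 n14] /andP[n23 n24] n34 _].
pose a u := (u.1 - u4.1)^-1.
have aN u u' : norm_adj h u w -> norm_adj h u' w -> u != u' -> a u != a u'.
  by move=> uw uw' uu'; rewrite (inj_eq invr_inj) neqA.
pose k u := h ^+ u.2 / h ^+ u4.2 * a u ^+ (q ^ 2 + q + 1).
pose rs := [seq (v.1 + u4.1)^-1 | v <- enum C].
have -> : #|C| = size rs by rewrite size_map cardE.
apply: (@norm_system_bound _ (a u1) (a u2) (a u3) (a u1 ^+ q) (a u2 ^+ q) (a u3 ^+ q)
  (a u1 ^+ (q ^ 2)) (a u2 ^+ (q ^ 2)) (a u3 ^+ (q ^ 2)) (k u1) (k u2) (k u3)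
  (fun x => x ^+ q) (fun x => x ^+ (q ^ 2))).
- exact: aN.
- exact: aN.
- by rewrite (inj_eq frobenius_inj) aN.
- by rewrite (inj_eq frobenius2_inj) aN.
- by rewrite !mulf_neq0 ?invr_eq0 ?h_neq0 // expf_neq0 // invr_eq0 inv0.
- rewrite map_inj_in_uniq ?enum_uniq // => v v'; rewrite !mem_enum !inE.
  move=> /and4P[_ _ _ v4] /and4P[_ _ _ v4'] /invr_inj/addIr; exact: norm_adj_injr v4 v4'.
move=> _ /mapP[v vC ->]; rewrite -!norm_polyE.
move: vC; rewrite mem_enum inE => /and4P[v1 v2 v3 v4].
have key u : norm_adj h u v -> norm_adj h u w -> u != u4 ->
    ((v.1 + u4.1)^-1 + a u) ^+ (q ^ 2 + q + 1) = k u.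
  move=> /eqP uv uw nu.
  have v0 : v.1 + u4.1 != 0.
    apply/eqP => v0; move/eqP: v4; rewrite (addrC _ v.1) v0 addn1 expr0n /= => /esym/eqP.
    by apply/negP.
  have -> : (v.1 + u4.1)^-1 + a u = (u.1 + v.1) / (u4.1 + v.1) * a u.
    rewrite /a; field; by rewrite inv0 // (addrC u4.1) v0 .
  rewrite /k exprMn; congr (_ * _); rewrite expr_div_n uv (eqP v4) !exprD.
  by field; rewrite !h_neq0.
by split; apply: key.
Qed.

(** For each [x] other than [- u.1], the norm of [u.1 + x] divided by [h ^+ u.2] is a root of unity
    of order dividing [q.-1], hence some [h ^+ j]. *)
Lemma norm_adj_degree u : (q ^ 3 - 1 <= #|[set v | norm_adj h u v]|)%N.
Proof.
have -> : (q ^ 3 - 1)%N = #|[set~ - u.1]| by rewrite cardsC1 cardL subn1.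
apply: leq_trans (leq_imset_card fst _); apply/subset_leq_card/subsetP=> x.
rewrite !inE => xu.
have ux0 : u.1 + x != 0 by apply: contraNneq xu => /eqP; rewrite (addrC u.1) addr_eq0.
have q1 : (0 < q)%N by have := prim_order_gt0 h_prim; lia.
have hq : (h ^+ q.-1 = 1) := prim_expr_order h_prim.
have [j ej] : {j : 'I_q.-1 | (u.1 + x) ^+ (q ^ 2 + q + 1) / h ^+ u.2 = h ^+ j}.
  apply: (prim_rootP h_prim); rewrite expr_div_n -!exprM (mulnC u.2) [h ^+ _]exprM hq expr1n divr1.
  (* As [(q ^ 2 + q + 1) * q.-1 + 1 = q ^ 3], this reduces to [frob3]. *)
  apply: (mulfI ux0); rewrite -exprS mulr1 -[RHS]frob3; congr (_ ^+ _).
  by case: (q) q1 => // r _ /=; rewrite !expnS; ring.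
apply/imsetP; exists (x, j) => //; by rewrite inE /norm_adj /= [h ^+ _]exprD -ej mulrC divfK.
Qed.
End NormGraph.

(** [h] is the power of a generator of the multiplicative group with exponent
    [(q ^ 3 - 1) / (q - 1)], where [q = 2 ^ m]. *)
Lemma norm_field_exists m : (0 < m)%N ->
  exists (L : finFieldType) (h : L),
    [/\ [pchar L].-nat (2 ^ m)%N, #|L| = ((2 ^ m) ^ 3)%N
      & (2 ^ m)%N.-1.-primitive_root h].
Proof.
move=> m0; have m30 : (0 < m * 3)%N by rewrite muln_gt0 m0.
have [L L2 cL] := pPrimePowerField (isT : prime 2) m30.
have cL' : #|L| = ((2 ^ m) ^ 3)%N by rewrite cL expnM.
set q := (2 ^ m)%N in cL' *.
have q1 : (1 < q)%N by rewrite -[1%N](expn0 2) ltn_exp2l.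
have [g gP] : exists g : L, #|L|.-1.-primitive_root g.
  have L1 := finNzRing_gt1 L.
  have /hasP[g _ gP] : has #|L|.-1.-primitive_root (enum [set~ (0 : L)]).
    apply: has_prim_root.
    - by lia.
    - apply/allP=> x; rewrite mem_enum !inE unity_rootE => x0; apply/eqP/(mulfI x0).
      by rewrite mulr1 -exprS prednK ?expf_card //; lia.
    - exact: enum_uniq.
    - by rewrite -cardE cardsC1.
  by exists g.
have dv : (q.-1 %| #|L|.-1)%N.
  rewrite cL' -(prednK (ltnW q1)) /=; apply/dvdnP; exists (q ^ 2 + q + 1)%N.
  by move: q1; case: (q) => // r _ /=; rewrite !expnS; lia.
exists L, (g ^+ (#|L|.-1 %/ q.-1)); split => //.
  by rewrite pnatX pnatE // L2.
exact: dvdn_prim_root.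
Qed.

End ProjectiveNormGraph.

(** * Assembling the lower bound *)

(** For [n] near [2 ^ (4 * k * s)] the left side is about [n^(11/4)]. The loss [2 ^ (8 * s)], about
    [n^(2/k)], comes from fixing the distance; [2 ^ (7 * k)] is constant for fixed [k]. *)
Lemma z3_lower k s n : 0 < k -> 0 < s -> 2 ^ (4 * k * s) <= n ->
  2 ^ (11 * k * s) <= 2 ^ (7 * k + 8 * s) * z3 n 2 2 7.
Proof.
(* The exponent [4 * s - 3] makes the [(3 * d) ^ k <= 2 ^ ((4 * s - 1) * k)] colours fit among the
   [q ^ 3 * q.-1 >= 2 ^ (4 * k * s - 1)] vertices. *)
move=> k0 s0 nbig; set q := 2 ^ (k * s); pose d := 2 ^ (4 * s - 3).
have ks0 : 0 < k * s by rewrite muln_gt0 k0.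
have [L [h [charL cardL prim_h]]] := norm_field_exists ks0.
rewrite -/q in charL cardL prim_h.
have q2 : 2 <= q by rewrite -[2]expn1 leq_exp2l.
have d0 : 0 < d by rewrite expn_gt0.
pose X : finType := {ffun 'I_k -> 'I_d}.
have [r Xr] := pigeonhole (fun p : X * X => sqdist_lt p.1 p.2 k0 d0).
have colors : #|{ffun 'I_k -> 'I_(3 * d)}| <= #|{: L * 'I_q.-1}|.
  rewrite card_ffun !card_ord card_prod card_ord cardL.
  apply: (@leq_trans ((2 ^ (4 * s - 1)) ^ k)).
    rewrite leq_exp2r // (_ : 4 * s - 1 = (4 * s - 3).+2); last by lia.
    by rewrite !expnS -/d; lia.
  apply: (@leq_trans (q ^ 3 * 2 ^ (k * s - 1))).
    by rewrite /q -!expnM -expnD leq_exp2l //; nia.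
  rewrite leq_mul2l; apply/orP; right; have : 0 < 2 ^ (k * s - 1) by rewrite expn_gt0.
  have -> : q = 2 * 2 ^ (k * s - 1) by rewrite -expnS /q; congr (_ ^ _); lia.
  by lia.
pose emb (c : {ffun 'I_k -> 'I_(3 * d)}) : L * 'I_q.-1 := enum_val (widen_ord colors (enum_rank c)).
have emb_inj : injective emb.
  by move=> c c' /enum_val_inj/(congr1 val)/= /val_inj/enum_rank_inj.
pose G (x y : X) := sqdist x y == r.
have freeA c1 c2 c3 c4 := @norm_adj_free L q h charL cardL prim_h c1 c2 c3 c4.
have rainbow (x x' y y' : X) : x != x' -> y != y' -> G x y -> G x y' -> G x' y -> G x' y' ->
    uniq [:: emb (third_term x y); emb (third_term x y');
             emb (third_term x' y); emb (third_term x' y')].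
  move=> xx yy g1 g2 g3 g4; have := third_term_rainbow xx yy g1 g2 g3 g4.
  by rewrite -(map_inj_uniq emb_inj).
have freeE := rectangle_free_comp freeA rainbow.
have degE := @card_comp_geq X X _ _ _ G (fun x y => emb (third_term x y)) _
  (norm_adj_degree charL cardL prim_h).
have cardX : #|X| = d ^ k by rewrite card_ffun !card_ord.
have Xn : #|X| <= n.
  rewrite cardX; apply: leq_trans nbig; rewrite /d -expnM leq_exp2l //; nia.
have Zn : #|{: L * 'I_q.-1}| <= n.
  rewrite card_prod cardL card_ord; apply: leq_trans nbig.
  apply: (@leq_trans (q ^ 4)); first by rewrite (expnSr q 3) leq_mul2l leq_pred orbT.
  by rewrite /q -expnM leq_exp2l //; lia.
have {}freeE := z3_geq (isT : 0 < 7) Xn Xn Zn freeE.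
have {freeE degE} := leq_trans degE freeE.
have {Xr} : d ^ k * d ^ k <= k * d ^ 2 * #|[set p : X * X | G p.1 p.2]|.
  by rewrite -cardX -card_prod.
set e := #|_|; set z := z3 _ _ _ _ => le1 le2.
have q3 : 2 ^ (3 * (k * s) - 1) <= q ^ 3 - 1.
  have : 0 < 2 ^ (3 * (k * s) - 1) by rewrite expn_gt0.
  rewrite (_ : q ^ 3 = 2 * 2 ^ (3 * (k * s) - 1)); first by lia.
  by rewrite -expnS /q -expnM; congr (_ ^ _); lia.
have kd : k * d ^ 2 <= 2 ^ (k + (8 * s - 6)).
  rewrite expnD leq_mul ?(ltnW (ltn_expl _ _)) // /d -expnM leq_exp2l //; lia.
have : 2 ^ ((8 * s - 6) * k) * 2 ^ (3 * (k * s) - 1) <= 2 ^ (k + (8 * s - 6)) * z.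
  apply: (@leq_trans (k * d ^ 2 * e * (q ^ 3 - 1))).
    apply: leq_mul q3; apply: leq_trans le1; rewrite /d -!expnM -expnD leq_exp2l //.
    by rewrite -mulnDr; nia.
  by rewrite -mulnA leq_mul.
(* This factor makes the exponent on the left exactly [11 * k * s], and the one on the right
   [7 * k + 8 * s - 5]. *)
rewrite -(leq_pmul2l (expn_gt0 2 (6 * k + 1))) mulnA -!expnD => le3.
apply: leq_trans (_ : 2 ^ (6 * k + 1 + (8 * s - 6) * k + (3 * (k * s) - 1)) <= _).
  by rewrite leq_exp2l //; nia.
apply: leq_trans le3 _; rewrite mulnA -expnD leq_mul2r leq_exp2l //.
by apply/orP; right; lia.
Qed.

(** * Asymptotics *)

From mathcomp Require Import all_classical all_reals all_analysis.
Import numFieldNormedType.Exports.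
Local Open Scope classical_set_scope.
Local Open Scope ring_scope.

Lemma ln_z3_upper (R : realType) n : (0 < n)%N -> (0 < z3 n 2 2 7)%N ->
  4 * ln ((z3 n 2 2 7)%:R : R) <= 3 * ln 2 + 11 * ln n%:R.
Proof.
move=> n0 z0.
have up : ((z3 n 2 2 7) ^ 4 <= 8 * n ^ 11)%N.
  (* [z3_leq] asks for a bound on [#|E|] itself, while only its fourth power is controlled; the
     maximum over all free sets mediates. *)
  have : (z3 n 2 2 7 <= \max_(E : {set 'I_n * 'I_n * 'I_n} | `[< rectangle_free 7 E >]) #|E|)%N.
    by apply: z3_leq => E freeE; apply: leq_bigmax_cond; apply/asboolP.
  set m := (\max_(_ | _) _)%N => zm; apply: (@leq_trans (m ^ 4)%N); first by rewrite leq_exp2r.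
  rewrite /m; elim/big_ind: _ => // [a b aP bP|E /asboolP]; last exact: rectangle_free_card.
  by rewrite /maxn; case: ifP.
have : ln (((z3 n 2 2 7) ^ 4)%:R : R) <= ln ((2 ^ 3 * n ^ 11)%:R : R).
  by rewrite ler_ln ?posrE ?ltr0n ?ler_nat ?muln_gt0 ?expn_gt0 ?z0 ?n0.
rewrite natrM !natrX lnM ?lnXn ?exprn_gt0 ?posrE ?exprn_gt0 ?ltr0n //.
rewrite -!(mulr_natl (ln _)); lra.
Qed.

Lemma ln_z3_lower (R : realType) k n : (0 < k)%N -> (2 ^ (4 * k) <= n)%N ->
  (0 < z3 n 2 2 7)%N /\
  (11 / 4 - 2 / k%:R) * ln (n%:R : R) - 18 * k%:R * ln 2 <= ln (z3 n 2 2 7)%:R.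
Proof.
move=> k0 nbig.
have n0 : (0 < n)%N by apply: leq_trans nbig; rewrite expn_gt0.
have b1 : (1 < 2 ^ (4 * k))%N by rewrite -[1%N](expn0 2) ltn_exp2l // muln_gt0.
(* Thus [2 ^ (4 * k * s) <= n < 2 ^ (4 * k * s.+1)]. Passing from [s.+1] to [s] costs [11 * k],
   which with [7 * k] from [z3_lower] gives the 18. *)
pose s := trunc_log (2 ^ (4 * k)) n.
have /andP[sn ns] := trunc_log_bounds b1 n0.
rewrite -/s -!expnM in sn ns.
have s0 : (0 < s)%N by rewrite /s trunc_log_gt0 b1 /=; lia.
have zb := z3_lower k0 s0 sn.
have z0 : (0 < z3 n 2 2 7)%N.
  have : (0 < 2 ^ (7 * k + 8 * s) * z3 n 2 2 7)%N by apply: leq_trans zb; rewrite expn_gt0.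
  by rewrite muln_gt0 => /andP[].
split=> //.
have lnE m : ln ((2 ^ m)%:R : R) = m%:R * ln 2 by rewrite natrX lnXn // mulr_natl.
have ln_mono a b : (0 < a)%N -> (a <= b)%N -> ln (a%:R : R) <= ln b%:R.
  by move=> a0 ab; rewrite ler_ln ?posrE ?ltr0n ?ler_nat // (leq_trans a0).
have := ln_mono _ _ _ sn; have := ln_mono _ _ n0 (ltnW ns); have := ln_mono _ _ _ zb.
rewrite natrM lnM ?posrE ?ltr0n ?expn_gt0 // !lnE => /(_ isT) h1 h2 /(_ isT) h3.
rewrite !(natrD, natrM) -!(natr1 s) in h1 h2 h3.
have kR : 0 < (k%:R : R) by rewrite ltr0n.
have c0 : 0 < ln (2 : R) by apply: ln_gt0; lra.
have h4 : 8 * s%:R * ln 2 <= 2 / k%:R * ln (n%:R : R).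
  have -> : 8 * s%:R * ln (2 : R) = 2 / k%:R * (4 * k%:R * s%:R * ln 2) by field; rewrite gt_eqF.
  by rewrite ler_pM2l ?divr_gt0.
nra.
Qed.

Theorem mainTheorem3 (R : realType) :
  (fun n : nat => ln ((z3 n 2 2 7)%:R : R) / ln (n%:R : R)) @ \oo --> (11%:R / 4%:R : R).
Proof.
apply/cvgrPdist_le => e e0.
(* This [k] brings the exponent loss [2 / k] down to [e / 2]. *)
have [k k0 ke] : exists2 k, (0 < k)%N & 4 / e <= k%:R.
  by exists (Num.truncn (4 / e)).+1 => //; apply/ltW/truncnS_gt.
have kR : 0 < (k%:R : R) by rewrite ltr0n.
have c0 : 0 < ln (2 : R) by apply: ln_gt0; lra.
have k2 : 2 / k%:R <= e / 2.
  by rewrite ler_pdivrMr // ler_pdivrMr // in ke *; lra.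
near=> n.
have nk : (2 ^ (4 * k) <= n)%N by near: n; apply: nbhs_infty_ge.
(* The other half of [e] absorbs [18 * k * ln 2]; as [1 <= k], the same threshold absorbs the
   additive term of the upper bound. *)
have nK : 36 * k%:R * ln 2 / e <= ln (n%:R : R).
  rewrite -[leLHS]expRK ler_ln ?posrE ?expR_gt0 ?ltr0n //.
    by near: n; apply: nbhs_infty_ger.
  by apply: leq_trans nk; rewrite expn_gt0.
have [z0 lo] := ln_z3_lower R k0 nk.
have n0 : (0 < n)%N by apply: leq_trans nk; rewrite expn_gt0.
have up := ln_z3_upper R n0 z0.
have l0 : 0 < ln (n%:R : R).
  by apply: lt_le_trans nK; rewrite divr_gt0 // mulr_gt0 // mulr_gt0.
rewrite ler_pdivrMr // in nK.
have k1 : 1 <= (k%:R : R) by rewrite ler1n.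
have nke : ln 2 <= k%:R * ln (2 : R) by rewrite ler_peMl // ltW.
have {}nK : 36 * (k%:R * ln 2) <= e * ln (n%:R : R).
  by move: nK; rewrite mulrA mulrC [e * _]mulrC; lra.
have kl : 2 / k%:R * ln (n%:R : R) <= e / 2 * ln n%:R by rewrite ler_pM2r.
have hi : ln (z3 n 2 2 7)%:R / ln (n%:R : R) <= 11 / 4 + e.
  by rewrite ler_pdivrMr // mulrDl; lra.
have {}lo : 11 / 4 - e <= ln (z3 n 2 2 7)%:R / ln (n%:R : R).
  move: lo; rewrite ler_pdivlMr // !mulrBl; lra.
by rewrite ler_norml; apply/andP; split; lra.
Unshelve. all: by end_near.
Qed.
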